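(* Let $n\ge 2$ and let $W$ be the Coxeter group of type $D_n$ with generator set $S$ and Coxeter graph $\Gamma_{D_n}$. Let $v\in W$ and consider the induced subgraph $\Gamma_{D_n}[S\setminus\mathrm{Des}(v)]$. Let $b_0$ be the connected component of this induced subgraph containing a vertex of degree three in it (with $b_0=\emptyset$ if no such vertex exists), and let $b_1,\ldots,b_k$ be the remaining connected components. Then the number of Boolean intervals $[v,w]$ in the right weak order of $W$ with minimal element $v$ and arbitrary maximal element $w$ (including $w=v$) is $$d_{|b_0|}\cdot\prod_{i=1}^k F_{|b_i|+2},$$ where $d_0=1$, $d_1=1$, $d_2=4$, $d_m=d_{m-1}+d_{m-2}$ for $m\ge3$, and $F_\ell$ is the $\ell$-th Fibonacci number with $F_1=F_2=1$.
   Context: Type $D_n$: generators $S=\{s_1,\ldots,s_{n-2},s_{n-1},s'_{n-1}\}$ with $m(s_i,s_{i+1})=3$ for $1\le i\le n-2$, $m(s_{n-2},s'_{n-1})=3$, and all other pairs of distinct generators commuting ($m=2$). The Coxeter graph $\Gamma_{D_n}$ has vertex set $S$ and an edge between $s,s'$ iff $m(s,s')\ge 3$. Right weak order: $u\le w$ iff $\ell(w)=\ell(u)+\ell(u^{-1}w)$. $\mathrm{Des}(v)=\{s\in S:\ell(vs)<\ell(v)\}$. An interval is Boolean if it is isomorphic to the lattice of subsets of a finite set. *)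

(* Defs.v *)
From HB Require Import structures.
From mathcomp Require Import all_boot.
From mathcomp Require Import boolp classical_sets functions cardinality.

Set Implicit Arguments.
Unset Strict Implicit.
Unset Printing Implicit Defensive.

(* (W, s) is a Coxeter system with matrix m, i.e. W is the group presented by
   < s_i | (s_i s_j)^(m i j) = 1 >. It is meant for matrices with finite
   entries and m i i = 1; the generators are then involutions, so generation
   needs only products of generators, without inverses. *)
Definition coxeter_relations (I : finType) (m : I -> I -> nat)
    (G : groupType) (f : I -> G) : Prop :=
  forall i j : I, ((f i * f j) ^+ m i j = 1)%g.

Definition coxeter_system (I : finType) (m : I -> I -> nat)
    (W : groupType) (s : I -> W) : Prop :=
  [/\ coxeter_relations m s,
      forall w : W, exists r : seq I, w = (\prod_(i <- r) s i)%g &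
      forall (G : groupType) (f : I -> G), coxeter_relations m f ->
        exists g : {multiplicative W -> G}, forall i : I, g (s i) = f i].

Section Weak_order.
Variables (I : finType) (W : groupType) (s : I -> W).
Local Open Scope classical_set_scope.

Definition word_of_size (w : W) (k : nat) : Prop :=
  exists2 r : seq I, size r = k & w = (\prod_(i <- r) s i)%g.

(* The default value 0 is irrelevant when s generates W. *)
Definition cox_length (w : W) : nat :=
  xget 0 [set k | word_of_size w k /\ forall j, word_of_size w j -> k <= j].

Definition descents (v : W) : {set I} :=
  [set i : I | cox_length (v * s i)%g < cox_length v]%SET.

Definition weak_le (u w : W) : Prop :=
  cox_length w = cox_length u + cox_length (u^-1 * w)%g.

Definition weak_interval (u w : W) : set W :=
  [set x | weak_le u x /\ weak_le x w].

Definition boolean_poset (A : set W) : Prop :=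
  exists (T : finType) (f : W -> {set T}),
    set_bij A [set: {set T}] f /\
    forall x y : W, A x -> A y -> (weak_le x y <-> f x \subset f y).

Definition boolean_intervals_from (v : W) : set (set W) :=
  [set A | exists w : W,
    [/\ weak_le v w, A = weak_interval v w & boolean_poset A]].
End Weak_order.

(* Index type of the generators of D_n: Some i (with i < n - 1) stands for
   s_(i+1), and None for s'_(n-1). *)
Definition D_gen (n : nat) : finType := option 'I_n.-1.

Definition D_matrix (n : nat) (x y : D_gen n) : nat :=
  match x, y with
  | Some i, Some j =>
      if i == j then 1
      else if (i.+1 == j :> nat) || (j.+1 == i :> nat) then 3 else 2
  | Some i, None | None, Some i =>
      (* s_(i+1) is s_(n-2) exactly when i + 3 = n *)
      if i + 3 == n then 3 else 2
  | None, None => 1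
  end.

(* Loop-free, as the diagonal entries of a Coxeter matrix are 1. *)
Definition coxeter_graph (I : finType) (m : I -> I -> nat) : rel I :=
  [rel x y | 3 <= m x y].

Section Graph.
Variables (T : finType) (e : rel T) (A : {set T}).

Definition induced_edge : rel T := [rel x y | [&& x \in A, y \in A & e x y]].

Definition components : {set {set T}} :=
  equivalence_partition (connect induced_edge) A.

Definition induced_degree (x : T) : nat := #|[set y | induced_edge x y]|.

(* A component with a vertex of degree three in the induced subgraph, or the
   empty set if there is none; induced subgraphs of the graph of D_n have at
   most one such component. *)
Definition branch_component : {set T} :=
  odflt finset.set0
    [pick B in components | [exists x in B, induced_degree x == 3]].
End Graph.

Fixpoint fib (l : nat) : nat :=
  if l is l1.+1 then (if l1 is l2.+1 then fib l1 + fib l2 else 1) else 0.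

Fixpoint d_seq (m : nat) : nat :=
  match m with
  | 0 => 1
  | 1 => 1
  | 2 => 4
  | (m2.+1 as m1).+1 => d_seq m1 + d_seq m2
  end.

(* Main.v *)
Require Import Defs.
From HB Require Import structures.
From mathcomp Require Import boolp classical_sets functions cardinality.
From mathcomp Require Import all_boot all_algebra all_fingroup.
From mathcomp Require Import zify ring.

Set Implicit Arguments.
Unset Strict Implicit.
Unset Printing Implicit Defensive.

(* An interval [v, w] is Boolean exactly when w = v * prod_(j in J) s_j for a
   set J of pairwise non-adjacent ascents of v.  For such J, the exchange
   property shows that the elements of the interval are the v * prod_(k in K) s_k
   with K a subset of J.  Conversely, the atoms of a Boolean interval are v * s_j
   with j an ascent; the join of two atoms gives s_i s_k = s_j s_l, and a
   reflection representation forces k = j, l = i, so that s_i and s_j commute,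
   and the same square above any element of the interval determines the rest.
   It remains to count independent sets of the graph induced on the ascents:
   the count is multiplicative over components, and removing an end vertex of an
   arm yields the Fibonacci recurrence, with initial values 4 and 5 on arms
   ending in the fork. *)

(** * Semidirect product of a group with Boolean functions on it *)

Section SignedConjugation.
Local Open Scope group_scope.
Variable W : groupType.

(** The semidirect product of [W] with the functions [W -> bool] under exclusive or, where [W] acts
    by conjugating the argument. Using functions on all of [W] avoids singling out the
    reflections. *)
Definition signed_conj : Type := (W * (W -> bool))%type.
HB.instance Definition _ := Choice.copy signed_conj (W * (W -> bool))%type.

Definition sconj_one : signed_conj := (1, fun=> false).
Definition sconj_inv (x : signed_conj) : signed_conj :=
  (x.1^-1, fun t => x.2 (t ^ x.1)).
Definition sconj_mul (x y : signed_conj) : signed_conj :=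
  (x.1 * y.1, fun t => x.2 (t ^ y.1^-1) (+) y.2 t).

Fact sconj_mulA : associative sconj_mul.
Proof.
move=> x y z; congr pair; first exact: mulgA.
by apply: funext => t /=; rewrite addbA invgM conjgM.
Qed.

Fact sconj_mul1 : left_id sconj_one sconj_mul.
Proof. by move=> [a N]; rewrite /sconj_mul /= mul1g. Qed.

Fact sconj_mulr1 : right_id sconj_one sconj_mul.
Proof.
move=> [a N]; rewrite /sconj_mul /= mulg1; congr pair.
by apply: funext => t /=; rewrite invg1 conjg1 addbF.
Qed.

Fact sconj_mulV : left_inverse sconj_one sconj_inv sconj_mul.
Proof.
move=> [a N]; rewrite /sconj_mul /= mulVg; congr pair.
by apply: funext => t /=; rewrite conjgKV addbb.
Qed.

Fact sconj_mulrV : right_inverse sconj_one sconj_inv sconj_mul.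
Proof.
move=> [a N]; rewrite /sconj_mul /= mulgV; congr pair.
by apply: funext => t /=; rewrite invgK addbb.
Qed.

HB.instance Definition _ := isGroup.Build signed_conj
  sconj_mulA sconj_mul1 sconj_mulr1 sconj_mulV sconj_mulrV.

Lemma sconj_mulE (x y : signed_conj) : x * y = sconj_mul x y.
Proof. by []. Qed.

(** The second component records inversions: a generator has itself as its only inversion. *)
Definition sconj_gen (a : W) : signed_conj := (a, fun t => t == a).

(** The involution [b] inverts the rotation [a * b], so conjugating a reflection of the dihedral
    group by a rotation shifts its index by twice the exponent. *)
Lemma dihedral_conjg (a b : W) j k : a * a = 1 -> b * b = 1 ->
  ((a * b) ^- j * b) ^ ((a * b) ^+ k) = (a * b) ^- (j + k.*2) * b.
Proof.
move=> aa bb; have bV : b^-1 = b by apply: mulg1_eq.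
have aV : a^-1 = a by apply: mulg1_eq.
have key : b * (a * b) ^+ k = (a * b) ^- k * b.
  apply: (mulIg b^-1); rewrite mulgK -expVgn -{1}[b]invgK -mulgA -conjgE conjXg.
  by rewrite conjgE invgK bV invgM aV bV -!mulgA bb mulg1.
rewrite conjgE -mulgA key -addnn addnCA addnA !expgnDr.
by rewrite !invgM !mulgA.
Qed.

(** Each further factor [sconj_gen a * sconj_gen b] contributes two reflections, [b] and [b a b]
    conjugated by [(a * b) ^+ k]; [dihedral_conjg] gives them the indices [k.*2] and [k.*2.+1]. *)
Lemma sconj_gen_expg (a b : W) k : a * a = 1 -> b * b = 1 ->
  (sconj_gen a * sconj_gen b) ^+ k =
    ((a * b) ^+ k, fun t =>
       \big[addb/false]_(0 <= j < k.*2) (t == (a * b) ^- j * b)) :> signed_conj.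
Proof.
move=> aa bb; elim: k => [|k IHk].
  by rewrite expg0; congr pair; apply: funext => t; rewrite big_nil.
rewrite expgS IHk !sconj_mulE /sconj_mul /= -expgS; congr pair.
apply: funext => t; rewrite doubleS !big_nat_recr //= addbC -!addbA.
have aV : a^-1 = a by apply: mulg1_eq.
have t0 : (t ^ (a * b) ^- k == b) = (t == (a * b) ^- k.*2 * b).
  by rewrite (can2_eq (conjgKV _) (conjgK _)) -(dihedral_conjg 0) // invg1 mul1g.
have t1 : ((t ^ (a * b) ^- k) ^ b^-1 == a) = (t == (a * b) ^- k.*2.+1 * b).
  rewrite !(can2_eq (conjgKV _) (conjgK _)) -add1n -dihedral_conjg //.
  by rewrite expg1 invgM aV -mulgA conjgE.
by rewrite t0 t1; congr (_ (+) _); rewrite addbC.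
Qed.

(* As [j] runs below [k.*2], each reflection [(a * b) ^- j * b] occurs twice. *)
Lemma sconj_gen_relation (a b : W) k :
    a * a = 1 -> b * b = 1 -> (a * b) ^+ k = 1 ->
  (sconj_gen a * sconj_gen b) ^+ k = 1.
Proof.
move=> aa bb abk; rewrite sconj_gen_expg // abk; congr pair; apply: funext => t.
rewrite -addnn (@big_cat_nat _ _ _ k) ?leq_addr //= -{2}[k]add0n big_addn addnK.
under [X in _ (+) X]eq_bigr do rewrite expgnDr abk mulg1.
exact: addbb.
Qed.
End SignedConjugation.

(** * Word length and weak order in a group generated by involutions *)

Section Length.
Local Open Scope group_scope.
Variables (I : finType) (W : groupType) (s : I -> W).
Hypothesis gen_s : forall w : W, exists r : seq I, w = \prod_(i <- r) s i.
Hypothesis invol_s : forall i, s i * s i = 1.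
Local Notation len := (cox_length s).
Local Notation "u <=w w" := (weak_le s u w) (at level 70).

Lemma gen_inv i : (s i)^-1 = s i.
Proof. exact: mulg1_eq. Qed.

Lemma gen_mulK i : involutive ( *%g^~ (s i)).
Proof. by move=> w; rewrite -mulgA invol_s mulg1. Qed.

Lemma cox_lengthP w :
  word_of_size s w (len w) /\ forall j, word_of_size s w j -> len w <= j.
Proof.
rewrite /cox_length; set P := (X in xget 0 X).
(* Since [s] generates, some word represents [w], so [xget] returns the minimum and not its default
   0. *)
suff ex_k : exists k, P k by exact: (xgetPex 0%N ex_k).
rewrite /P; have [r ->] := gen_s w.
have ex_k : exists k, `[< word_of_size s (\prod_(i <- r) s i) k >].
  by exists (size r); apply/asboolP; exists r.
have [k /asboolP wk kmin] := ex_minnP ex_k.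
by exists k; split=> // j wj; apply/kmin/asboolP.
Qed.

Lemma cox_length_word r : len (\prod_(i <- r) s i) <= size r.
Proof. by have [_ ->//] := cox_lengthP (\prod_(i <- r) s i); exists r. Qed.

Lemma reduced_word w : exists2 r, size r = len w & w = \prod_(i <- r) s i.
Proof. by have [] := cox_lengthP w. Qed.

Lemma cox_length1 : len 1 = 0%N.
Proof. by have := cox_length_word [::]; rewrite big_nil leqn0 => /eqP. Qed.

Lemma cox_length_eq0 w : len w = 0%N -> w = 1.
Proof. by have [r <- ->] := reduced_word w; case: r; rewrite ?big_nil. Qed.

Lemma cox_lengthM u w : len (u * w) <= len u + len w.
Proof.
have [r <- {1}->] := reduced_word u; have [r' <- {1}->] := reduced_word w.
by rewrite -big_cat -size_cat cox_length_word.
Qed.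

Lemma cox_length_gen i : len (s i) <= 1.
Proof. by have := cox_length_word [:: i]; rewrite big_seq1. Qed.

Lemma cox_lengthV_le w : len w^-1 <= len w.
Proof.
have [r <- ->] := reduced_word w; rewrite -size_rev.
suff -> : (\prod_(i <- r) s i)^-1 = \prod_(i <- rev r) s i.
  exact: cox_length_word.
elim: r => [|i r IHr]; first by rewrite !big_nil invg1.
by rewrite rev_cons -cats1 big_cat big_seq1 big_cons invgM gen_inv IHr.
Qed.

Lemma cox_lengthV w : len w^-1 = len w.
Proof.
by apply/eqP; rewrite eqn_leq cox_lengthV_le -{1}[w]invgK cox_lengthV_le.
Qed.

Lemma weak_le_mulr u x : u <=w u * x <-> len (u * x) = (len u + len x)%N.
Proof. by rewrite /weak_le mulKg. Qed.

Lemma weak_le_refl u : u <=w u.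
Proof. by rewrite /weak_le mulVg cox_length1 addn0. Qed.

Lemma weak_le_trans u w z : u <=w w -> w <=w z -> u <=w z.
Proof.
rewrite /weak_le => uw wz; apply/eqP; rewrite eqn_leq; apply/andP; split.
  by rewrite -{1}[z](mulVKg u) cox_lengthM.
rewrite wz uw -addnA leq_add2l.
by have := cox_lengthM (u^-1 * w) (w^-1 * z); rewrite mulgA mulgK.
Qed.

Lemma weak_le_anti u w : u <=w w -> w <=w u -> u = w.
Proof.
rewrite /weak_le => uw wu; have l0 : len (u^-1 * w) = 0%N by lia.
by rewrite -[w](mulVKg u) (cox_length_eq0 l0) mulg1.
Qed.

Lemma weak_le_length u w : u <=w w -> len u <= len w.
Proof. by rewrite /weak_le => ->; rewrite leq_addr. Qed.

(** The letter [i] is the first one of a reduced word for [u^-1 * w]; subadditivity of the length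
    then forces equality on both sides of [u * s i]. *)
Lemma weak_le_step u w : u <=w w -> u <> w ->
  exists i, [/\ u <=w u * s i, u * s i <=w w & len (u * s i) = (len u).+1].
Proof.
move=> uw neq_uw; have [[|i r] rl rE] := reduced_word (u^-1 * w).
  by case: neq_uw; rewrite -[w](mulVKg u) rE big_nil mulg1.
exists i; rewrite /weak_le mulKg.
have wE : (u * s i)^-1 * w = \prod_(j <- r) s j.
  by rewrite invgM gen_inv -mulgA rE big_cons mulgA invol_s mul1g.
have := cox_length_word r; rewrite -wE.
have := cox_lengthM (u * s i) ((u * s i)^-1 * w); rewrite mulVKg.
have := cox_lengthM u (s i); have := cox_length_gen i.
move: uw rl; rewrite /weak_le /=; move=> *; split; lia.
Qed.

End Length.

Definition simply_laced (I : finType) (m : I -> I -> nat) : Prop :=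
  [/\ forall i, m i i = 1,
      forall i j, m i j = m j i &
      forall i j, i != j -> m i j = 2 \/ m i j = 3].

(** * Inversions and the exchange property *)

Section Exchange.
Local Open Scope group_scope.
Variables (I : finType) (m : I -> I -> nat) (W : groupType) (s : I -> W).
Hypothesis m_diag : forall i, m i i = 1%N.
Hypothesis hW : coxeter_system m s.
Local Notation len := (cox_length s).

Lemma coxeter_gen w : exists r : seq I, w = \prod_(i <- r) s i.
Proof. by case: hW. Qed.

Lemma coxeter_invol i : s i * s i = 1.
Proof. by case: hW => /(_ i i); rewrite m_diag. Qed.

Let gen_s := coxeter_gen.
Let invol_s := coxeter_invol.

(* [N w] is the indicator of the right inversions of [w]; it is well defined
   because it is the second component of a homomorphism to [signed_conj W]. *)
Lemma inversion_cocycle : exists N : W -> W -> bool,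
  (forall u w t, N (u * w) t = N u (t ^ w^-1) (+) N w t) /\
  (forall i t, N (s i) t = (t == s i)).
Proof.
have [rel_s _ univ] := hW.
have [|g gE] := univ (signed_conj W) (fun i => sconj_gen (s i)).
  by move=> i j; apply: sconj_gen_relation.
have g1 w : (g w).1 = w.
  have [r ->] := gen_s w; elim: r => [|i r IHr]; last first.
    by rewrite big_cons gmulfM sconj_mulE /= IHr gE.
  rewrite big_nil; apply: (mulgI (g 1).1).
  by rewrite -[LHS]/(g 1 * g 1).1 -gmulfM !mulg1.
exists (fun w => (g w).2); split=> [u w t|i t]; last by rewrite gE.
by rewrite gmulfM sconj_mulE /= g1.
Qed.

Definition inversion := projT1 (cid inversion_cocycle).

Lemma inversionM u w t : inversion (u * w) t = inversion u (t ^ w^-1) (+) inversion w t.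
Proof. by rewrite /inversion; case: cid => N []. Qed.

Lemma inversion_gen i t : inversion (s i) t = (t == s i).
Proof. by rewrite /inversion; case: cid => N []. Qed.

Lemma inversion1 t : inversion 1 t = false.
Proof.
have := inversionM 1 1 t; rewrite mulg1 invg1 conjg1.
by case: inversion.
Qed.

(** By the cocycle identity, either [t] conjugated past the tail is the first letter, which then
    cancels, or [t] is already an inversion of the tail and induction applies. *)
Lemma exchange r t : inversion (\prod_(i <- r) s i) t ->
  exists2 r', size r' < size r & (\prod_(i <- r) s i) * t = \prod_(i <- r') s i.
Proof.
elim: r => [|i r IHr]; first by rewrite big_nil inversion1.
rewrite big_cons inversionM inversion_gen; case: eqP => [Ht _|_ /IHr[r' lt_r' rE]].
  exists r => //; by rewrite -mulgA [_ * t]conjgCV Ht mulgA invol_s mul1g.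
by exists (i :: r') => //; rewrite big_cons -rE mulgA.
Qed.

Lemma inversion_length w i : inversion w (s i) -> len (w * s i) < len w.
Proof.
have [r <- ->] := reduced_word gen_s w => /exchange[r' lt_r' ->].
exact: leq_ltn_trans (cox_length_word gen_s r') lt_r'.
Qed.

(** If [s i] is not an inversion of [w], the cocycle identity makes it one of [w * s i], and
    multiplying once more by [s i] shows that [w] is the shorter of the two. *)
Lemma descentE w i : (i \in descents s w) = inversion w (s i).
Proof.
rewrite inE; apply/idP/idP; last exact: inversion_length.
apply: contraTT => Nwi; rewrite -leqNgt ltnW //.
rewrite -{1}[w](gen_mulK invol_s i); apply: inversion_length.
by rewrite inversionM gen_inv // conjgE mulKg inversion_gen eqxx (negbTE Nwi).
Qed.

(** Equal lengths are impossible: [s i] is an inversion of [w * s i], so multiplying back strictly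
    shortens. *)
Lemma length_ascent w i : i \notin descents s w -> len (w * s i) = (len w).+1.
Proof.
move=> wi; have Nwi : inversion (w * s i) (s i).
  rewrite inversionM gen_inv // conjgE mulKg.
  by rewrite inversion_gen eqxx -descentE (negbTE wi).
have := inversion_length Nwi; rewrite (gen_mulK invol_s).
have := cox_lengthM gen_s w (s i); have := cox_length_gen gen_s i.
lia.
Qed.

End Exchange.

(** * A reflection representation for simply laced matrices *)

Section Reflections.
Import GRing.Theory.
Local Open Scope ring_scope.
Variables (I : finType) (m : I -> I -> nat).
Hypothesis m_sl : simply_laced m.

(* The dual of the geometric representation, reduced modulo 3. *)
Definition cartan (i j : I) : 'F_3 := if i == j then - 2%:R else (m i j == 3%N)%:R.

(** Over a finite field the vectors form a finite type, so the reflections live in a permutation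
    group. In ['F_3] the values 1, 0 and -1 remain distinct, which is all that the later coordinate
    arguments compare. *)
Definition reflect_fun (i : I) (x : {ffun I -> 'F_3}) : {ffun I -> 'F_3} :=
  [ffun k => x k + cartan i k * x i].

Lemma cartan_diag i : cartan i i = - 2%:R.
Proof. by rewrite /cartan eqxx. Qed.

Lemma cartanE i j : i != j -> cartan i j = (m i j == 3%N)%:R.
Proof. by rewrite /cartan => /negbTE->. Qed.

Lemma reflect_funK i : involutive (reflect_fun i).
Proof. by move=> x; apply/ffunP => k; rewrite !ffunE cartan_diag; ring. Qed.

Definition reflect_perm i : {perm {ffun I -> 'F_3}} :=
  perm (can_inj (reflect_funK i)).

Lemma reflect_permE i x : reflect_perm i x = reflect_fun i x.
Proof. exact: permE. Qed.

Lemma reflect_perm_relations : coxeter_relations m reflect_perm.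
Proof.
have [m_diag m_sym m23] := m_sl => i j.
have invol k : (reflect_perm k * reflect_perm k = 1)%g.
  by apply/permP => x; rewrite permM !reflect_permE perm1 reflect_funK.
have [->|neq_ij] := eqVneq i j; first by rewrite m_diag expg1 invol.
have neq_ji : j != i by rewrite eq_sym.
have cij := cartanE neq_ij; have cji := cartanE neq_ji; rewrite m_sym in cji.
case: (m23 i j neq_ij) => mij; rewrite mij ?eqxx /= in cij cji *.
  suff ijC : (reflect_perm i * reflect_perm j = reflect_perm j * reflect_perm i)%g.
    by rewrite expgS expg1 {2}ijC mulgA -(mulgA (reflect_perm i)) invol mulg1 invol.
  apply/permP => x; rewrite !permM !reflect_permE; apply/ffunP => k.
  by rewrite !ffunE cij cji; ring.
have braid : (reflect_perm i * reflect_perm j * reflect_perm i =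
              reflect_perm j * reflect_perm i * reflect_perm j)%g.
  apply/permP => x; rewrite !permM !reflect_permE; apply/ffunP => k.
  by rewrite !ffunE cij cji !cartan_diag; ring.
rewrite !expgS expg0 mulg1 !mulgA braid.
rewrite -(mulgA _ (reflect_perm j) (reflect_perm j)) invol mulg1.
by rewrite -(mulgA _ (reflect_perm i) (reflect_perm i)) invol mulg1 invol.
Qed.

Definition unit_fun (i : I) : {ffun I -> 'F_3} := [ffun k => (k == i)%:R].

Lemma reflect_unit_id i : reflect_fun i (unit_fun i) i = -1.
Proof. by rewrite !ffunE eqxx cartan_diag mulr1n; ring. Qed.

Lemma reflect_unit_neq i j : i != j -> reflect_fun j (unit_fun i) = unit_fun i.
Proof.
move=> neq_ij; apply/ffunP => k; rewrite !ffunE [j == i]eq_sym (negbTE neq_ij).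
by rewrite mulr0 addr0.
Qed.

Lemma reflect_unit2 i k : i != k ->
  reflect_fun k (reflect_fun i (unit_fun i)) i != 1.
Proof.
have [_ m_sym _] := m_sl => neq_ik; have neq_ki : k != i by rewrite eq_sym.
rewrite ffunE reflect_unit_id !ffunE eqxx (negbTE neq_ki) !cartanE //.
by rewrite [m k i]m_sym; case: (m i k == 3%N).
Qed.

Variables (W : groupType) (s : I -> W).
Hypothesis hW : coxeter_system m s.
Local Open Scope group_scope.

Lemma reflection_rep : exists g : {multiplicative W -> {perm {ffun I -> 'F_3}}},
  forall i x, g (s i) x = reflect_fun i x.
Proof.
have [_ _ univ] := hW; have [g gE] := univ _ _ reflect_perm_relations.
by exists g => i x; rewrite gE reflect_permE.
Qed.

Lemma coxeter_gen_inj : injective s.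
Proof.
move=> i j sij; apply/eqP/negP => /negP neq_ij; have [g gE] := reflection_rep.
have := gE i (unit_fun i); rewrite sij gE reflect_unit_neq // => /ffunP/(_ i).
by rewrite reflect_unit_id ffunE eqxx.
Qed.

(** Both sides act on [unit_fun i]. Were [l] also different from [i], the right side would fix it,
    while the left side changes its coordinate at [i] by [reflect_unit2]. *)
Lemma gen_mul2_eq_r i j k l : i != j -> i != k -> s i * s k = s j * s l -> l = i.
Proof.
move=> neq_ij neq_ik skl; apply/eqP; apply: contraT; rewrite eq_sym => neq_il.
have [g gE] := reflection_rep; case/negP: (reflect_unit2 neq_ik).
have := congr1 (fun w => g w (unit_fun i) i) skl.
rewrite /= !gmulfM !permM !gE !(reflect_unit_neq neq_ij) => ->.
by rewrite (reflect_unit_neq neq_il) ffunE eqxx.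
Qed.

Lemma gen_mul2_eq i j k l : i != j -> i != k -> j != l ->
  s i * s k = s j * s l -> [/\ k = j, l = i & s i * s j = s j * s i].
Proof.
move=> neq_ij neq_ik neq_jl skl; have li := gen_mul2_eq_r neq_ij neq_ik skl.
rewrite eq_sym in neq_ij; have kj := gen_mul2_eq_r neq_ij neq_jl (esym skl).
by rewrite {1}kj li in skl.
Qed.

Lemma gen_commuteP i j : i != j -> reflect (commute (s i) (s j)) (m i j != 3%N).
Proof.
have [m_diag _ m23] := m_sl; have [rel_s _ _] := hW => neq_ij.
have inv_s := gen_inv (coxeter_invol m_diag hW).
have mulss := coxeter_invol m_diag hW.
have relij := rel_s i j; apply: (iffP idP) => [|sijC].
  case: (m23 i j neq_ij) relij => -> // relij _.
  rewrite /commute -[s j * s i]invgK invgM !inv_s.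
  exact/esym/mulg1_eq.
apply/negP => /eqP mij; case/eqP: neq_ij; apply: coxeter_gen_inj.
(* Commutation gives exponent 2 and [m i j = 3] gives exponent 3, so [s i * s j = 1], against the
   injectivity of [s]. *)
have sij2 : (s i * s j) ^+ 2 = 1 by rewrite expgMn // !expgS !mulg1 !mulss mulg1.
by move: relij; rewrite mij expgS sij2 mulg1 => /mulg1_eq; rewrite inv_s.
Qed.
End Reflections.

(** * Independent sets and products of commuting factors *)

Definition independent (T : finType) (e : rel T) (K : {set T}) : bool :=
  [forall x in K, forall y in K, ~~ e x y].

Lemma independentP (T : finType) (e : rel T) (K : {set T}) :
  reflect {in K &, forall x y, ~~ e x y} (independent e K).
Proof.
apply: (iffP forall_inP) => [Ke x y xK yK|Ke x xK].
  by have /forall_inP := Ke x xK; apply.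
by apply/forall_inP => y; apply: Ke.
Qed.

Lemma independentS (T : finType) (e : rel T) (K L : {set T}) :
  K \subset L -> independent e L -> independent e K.
Proof.
move=> /subsetP sKL /independentP Le; apply/independentP => x y xK yK.
by apply: Le; apply: sKL.
Qed.

(** Induction on the enumeration of [I]: it has no repetitions, so the factor at [i] occurs once and
    can be moved to the right past all later factors. *)
Lemma prod_setD1_commute (G : monoidType) (I : finType) (F : I -> G)
    (K : {set I}) (i : I) :
  i \in K -> {in K, forall j, commute (F i) (F j)} ->
  (\prod_(j in K) F j = (\prod_(j in K :\ i) F j) * F i)%g.
Proof.
move=> iK FiK; have := index_enum_uniq I.
have : i \in index_enum I by rewrite mem_index_enum.
elim: (index_enum I) => // k r IHr; rewrite inE !big_cons in_setD1 /=.
case: eqVneq => [<- _|neq_ik /= ir] /andP[kr /IHr{}IHr]; last first.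
  by rewrite IHr //=; case: ifP; rewrite // mulgA.
have -> : (\prod_(j <- r | j \in K :\ i) F j = \prod_(j <- r | j \in K) F j)%g.
  rewrite big_seq_cond [RHS]big_seq_cond; apply: eq_bigl => j; rewrite in_setD1.
  by case: eqVneq => // ->; rewrite (negbTE kr).
by rewrite /= iK; apply: commute_prod.
Qed.

Lemma card_finset (T : finType) (S : {set T}) : ([set` S] #= `I_#|S|)%card.
Proof.
have -> : [set` S]%classic = (enum_val (A := mem S) @` classical_sets.setT)%classic.
  apply/seteqP; split=> [x /= xS|_ [i _ <-]]; last exact: enum_valP.
  by exists (enum_rank_in xS x); rewrite // enum_rankK_in.
apply: card_eq_trans (inj_card_eq _) (card_esym card_II).
exact: in2W enum_val_inj.
Qed.

(** * Boolean intervals and independent sets of ascents *)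

Section BooleanIntervals.
Local Open Scope group_scope.
Variables (I : finType) (m : I -> I -> nat) (W : groupType) (s : I -> W).
Hypothesis m_sl : simply_laced m.
Hypothesis hW : coxeter_system m s.
Local Notation len := (cox_length s).
Local Notation e := (coxeter_graph m).
Local Notation "u <=w w" := (weak_le s u w) (at level 70).

Let m_diag : forall i, m i i = 1%N. Proof. by case: m_sl. Qed.
Let gen_s := coxeter_gen hW.
Let invol_s := coxeter_invol m_diag hW.

Lemma edge_commuteP i j : reflect (commute (s i) (s j)) (~~ e i j).
Proof.
have [_ _ m23] := m_sl; have [->|neq_ij] := eqVneq i j.
  by rewrite /coxeter_graph /= m_diag; apply: ReflectT.
have -> : ~~ e i j = (m i j != 3%N).
  have : m i j = 2 \/ m i j = 3 by apply: m23.
  by rewrite /coxeter_graph /=; case=> ->.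
exact: (gen_commuteP m_sl hW neq_ij).
Qed.

Definition gen_prod (K : {set I}) : W := \prod_(i in K) s i.

Lemma gen_prod0 : gen_prod finset.set0 = 1.
Proof. by rewrite /gen_prod big_set0. Qed.

Lemma gen_prodD1 K i : independent e K -> i \in K ->
  gen_prod K = gen_prod (K :\ i)%SET * s i.
Proof.
move=> /independentP Ke iK; apply: prod_setD1_commute => // j jK.
exact/edge_commuteP/Ke.
Qed.

Lemma indep_ind (P : {set I} -> Prop) :
    P finset.set0 ->
    (forall K i, independent e K -> i \in K -> P (K :\ i)%SET -> P K) ->
  forall K, independent e K -> P K.
Proof.
move=> P0 PS K; move: {2}#|K| (erefl #|K|) => n; elim: n K => [|n IHn] K.
  by move/eqP; rewrite cards_eq0 => /eqP->.
move=> cardK Ke; have /card_gt0P[i iK] : 0 < #|K| by rewrite cardK.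
apply: (PS K i) => //; apply: IHn; last exact: independentS (subD1set K i) Ke.
by move: cardK; rewrite (cardsD1 i K) iK => -[].
Qed.

(** Conjugation by a factor fixes all the other factors, so the cocycle identity adds up their
    indicators; these never cancel because [s] is injective. *)
Lemma inversion_gen_prod K t : independent e K ->
  inversion m_diag hW (gen_prod K) t = [exists i in K, t == s i].
Proof.
move=> Ke; elim/indep_ind: K / Ke t => [|K i Ke iK IHK] t.
  rewrite gen_prod0 inversion1; apply/esym/existsP => -[i]; by rewrite inE.
rewrite (gen_prodD1 Ke iK) inversionM IHK inversion_gen gen_inv //.
have -> : [exists j in K, t == s j] = (t == s i) || [exists j in K :\ i, t == s j].
  apply/exists_inP/orP => [[j jK tj]|[ti|/exists_inP[j]]].
  - have [<-|neq_ji] := eqVneq j i; [by left | right].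
    by apply/exists_inP; exists j; rewrite // !inE neq_ji.
  - by exists i.
  - by rewrite inE => /andP[_ jK] tj; exists j.
have eqtj j : j \in K -> (t ^ s i == s j) = (t == s j).
  move=> jK; have sij : s j ^ s i = s j.
    apply/conjg_fixP/commgP/edge_commuteP.
    by move/independentP: Ke; apply.
  by rewrite -{1}sij (inj_eq (conjg_inj _)).
have -> : [exists j in K :\ i, t ^ s i == s j] = [exists j in K :\ i, t == s j].
  by apply: eq_existsb => j; rewrite inE; case: (boolP (j \in K)) => [/eqtj->|];
    rewrite ?andbF.
case: eqP => [->|] /=; last by rewrite addbF.
rewrite addbT; apply/exists_inP => -[j]; rewrite !inE => /andP[/eqP neq_ji _].
by move/eqP/(coxeter_gen_inj m_sl hW)/esym.
Qed.

Lemma descents_gen_prod K : independent e K -> descents s (gen_prod K) = K.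
Proof.
move=> Ke; apply/setP => i; rewrite (descentE m_diag hW) inversion_gen_prod //.
apply/exists_inP/idP => [[j jK /eqP/(coxeter_gen_inj m_sl hW)->]//|iK].
by exists i.
Qed.

(** Each new factor [s i] is still an ascent: it commutes with the previous product, which does not
    have it as an inversion, so the cocycle identity reduces the question to [v]. *)
Lemma length_mul_gen_prod v K : independent e K -> K \subset ~: descents s v ->
  len (v * gen_prod K) = (len v + #|K|)%N.
Proof.
move=> Ke; elim/indep_ind: K / Ke => [|K i Ke iK IHK] sK.
  by rewrite gen_prod0 mulg1 cards0 addn0.
have sKi : K :\ i \subset K := subD1set K i.
rewrite (cardsD1 i K) iK addnCA add1n -IHK ?(subset_trans sKi) //.
rewrite (gen_prodD1 Ke iK) mulgA (length_ascent m_diag hW) //.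
rewrite (descentE m_diag hW) inversionM -(descentE m_diag hW).
rewrite descents_gen_prod; last first.
  exact: independentS Ke.
rewrite !inE eqxx addbF.
have -> : s i ^ (gen_prod (K :\ i))^-1 = s i.
  apply/conjg_fixP/commgP/commuteV/commute_prod => j /setD1P[_ jK].
  by apply/edge_commuteP; move/independentP: Ke; apply.
by rewrite -(descentE m_diag hW); have /subsetP/(_ i iK) := sK; rewrite inE.
Qed.

Lemma gen_prodV K : independent e K -> (gen_prod K)^-1 = gen_prod K.
Proof.
move=> Ke; elim/indep_ind: K / Ke => [|K i Ke iK IHK].
  by rewrite gen_prod0 invg1.
rewrite (gen_prodD1 Ke iK) invgM IHK gen_inv //.
apply: commute_prod => j /setD1P[_ jK].
by apply/edge_commuteP; move/independentP: Ke; apply.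
Qed.

Lemma gen_prodD (K L : {set I}) : independent e L -> K \subset L ->
  gen_prod K * gen_prod (L :\: K) = gen_prod L.
Proof.
move=> Le; elim/indep_ind: L / Le K => [|L i Le iL IHL] K.
  by rewrite subset0 => /eqP->; rewrite set0D gen_prod0 mulg1.
move=> sKL; have [iK|iK] := boolP (i \in K).
  have Ke := independentS sKL Le.
  rewrite (gen_prodD1 Ke iK) (gen_prodD1 Le iL) -(IHL (K :\ i)) ?setSD //.
  have -> : (L :\ i) :\: (K :\ i) = L :\: K.
    by apply/setP => j; rewrite !inE; case: eqVneq => [->|]; rewrite ?iK.
  rewrite -!mulgA; congr (_ * _); apply: commute_prod => j /setDP[jL _].
  by apply/edge_commuteP; move/independentP: Le; apply.
have iLK : i \in L :\: K by rewrite inE iK.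
rewrite (gen_prodD1 Le iL) -(IHL K) ?subsetD1 ?sKL // -mulgA.
rewrite setDDl setUC -setDDl -gen_prodD1 //; exact: independentS (subsetDl L K) Le.
Qed.

Definition ascent_set v (K : {set I}) : bool :=
  independent e K && (K \subset ~: descents s v).

Lemma ascent_setS v (K L : {set I}) :
  K \subset L -> ascent_set v L -> ascent_set v K.
Proof.
move=> sKL /andP[Le sL]; rewrite /ascent_set (independentS sKL Le) /=.
exact: subset_trans sL.
Qed.

Lemma length_gen_prod (K : {set I}) : independent e K -> len (gen_prod K) = #|K|.
Proof.
move=> Ke; rewrite -[gen_prod K]mul1g length_mul_gen_prod ?(cox_length1 gen_s) //.
by apply/subsetP => i _; rewrite inE (descentE m_diag hW) inversion1.
Qed.

Lemma weak_le_gen_prod v (K L : {set I}) : ascent_set v L -> K \subset L ->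
  v * gen_prod K <=w v * gen_prod L.
Proof.
move=> Lv sKL; have /andP[Le sL] := Lv; have /andP[Ke sK] := ascent_setS sKL Lv.
have sLK := subsetDl L K; have /andP[Me sM] := ascent_setS sLK Lv.
rewrite -(gen_prodD Le sKL) mulgA; apply/weak_le_mulr.
rewrite -mulgA gen_prodD // !length_mul_gen_prod // -addnA; congr addn.
by rewrite length_gen_prod // -(cardsID K L) (setIidPr sKL).
Qed.

Lemma gen_prod_inj (K L : {set I}) : independent e K -> independent e L ->
  gen_prod K = gen_prod L -> K = L.
Proof.
by move=> Ke Le KL; rewrite -(descents_gen_prod Ke) KL descents_gen_prod.
Qed.

Lemma weak_interval_gen_prod v J x : ascent_set v J ->
  weak_interval s v (v * gen_prod J) x <->
  exists2 K : {set I}, K \subset J & x = v * gen_prod K.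
Proof.
move=> Jv; have /andP[Je _] := Jv; split=> [[]|[K sKJ ->]]; last first.
  split; last exact: weak_le_gen_prod.
  rewrite -{1}[v]mulg1 -gen_prod0; apply: weak_le_gen_prod; last exact: sub0set.
  exact: ascent_setS Jv.
(* Climb from [v] towards [x] by covers, enlarging [K] by one index at each step; [n] bounds the
   length still to be gained. *)
suff up n (K : {set I}) : K \subset J -> len x - len (v * gen_prod K) <= n ->
    v * gen_prod K <=w x -> x <=w v * gen_prod J ->
    exists2 K : {set I}, K \subset J & x = v * gen_prod K.
  move=> vx; apply: (up _ finset.set0 _ (leqnn _)); first exact: sub0set.
  by rewrite gen_prod0 mulg1.
elim: n K => [|n IHn] K sKJ le_n leKx lexJ.
all: have [xE|/(weak_le_step gen_s invol_s leKx)[i [_ le_ix len_i]]] :=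
  pselect (v * gen_prod K = x).
1,3: by exists K.
  by have := weak_le_length le_ix; rewrite len_i; lia.
have le_iJ := weak_le_trans gen_s le_ix lexJ.
have Ke : independent e K := independentS sKJ Je.
have Me : independent e (J :\: K) := independentS (subsetDl J K) Je.
(* The cover makes [s i] a left descent of [gen_prod (J :\: K)]. This product is its own inverse, so
   [i] is also a right descent, and these form exactly [J :\: K]. *)
have iM : i \in J :\: K.
  rewrite -(descents_gen_prod Me) inE (length_gen_prod Me).
  rewrite -(cox_lengthV gen_s invol_s) invgM (gen_prodV Me) (gen_inv invol_s).
  have := weak_le_gen_prod Jv sKJ; move: le_iJ; rewrite /weak_le len_i.
  rewrite -(gen_prodD Je sKJ) !invgM -!mulgA !mulKg (gen_inv invol_s).
  by rewrite (length_gen_prod Me) => -> /eqP; rewrite addSn -addnS eqn_add2l => /eqP->.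
have /setDP[iJ iK] := iM; have sKiJ : i |: K \subset J by rewrite subUset sub1set iJ.
have KiE : v * gen_prod K * s i = v * gen_prod (i |: K).
  by rewrite (gen_prodD1 (independentS sKiJ Je) (setU11 i K)) setU1K ?mulgA.
by apply: (IHn (i |: K)) => //; rewrite -KiE // len_i; lia.
Qed.

Lemma boolean_gen_prod v J : ascent_set v J ->
  boolean_poset s (weak_interval s v (v * gen_prod J)).
Proof.
move=> Jv; have /andP[Je _] := Jv.
(* The set [K] is recovered as the descent set of [v^-1 * x]; the subtype of elements of [J] serves
   as the finite ground set. *)
pose f x := [set t : {i : I | i \in J} | val t \in descents s (v^-1 * x)].
have fE (K : {set I}) : K \subset J -> f (v * gen_prod K) = val @^-1: K.
  move=> sKJ; apply/setP => t.
  rewrite [LHS]inE [RHS]inE mulKg descents_gen_prod //; exact: independentS Je.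
have f_sub (K L : {set I}) : K \subset J -> L \subset J ->
    (f (v * gen_prod K) \subset f (v * gen_prod L)) = (K \subset L).
  move=> sKJ sLJ; rewrite !fE //; apply/subsetP/subsetP => sKL i.
    by move=> iK; have := sKL (exist _ i (subsetP sKJ i iK)); rewrite !inE; apply.
  by rewrite !inE; apply: sKL.
have f_le (K L : {set I}) : K \subset J -> L \subset J ->
    v * gen_prod K <=w v * gen_prod L <-> K \subset L.
  move=> sKJ sLJ; have Lv := ascent_setS sLJ Jv.
  split=> [leKL|]; last exact: weak_le_gen_prod.
  have [|K' sK'L] := (weak_interval_gen_prod (v * gen_prod K) Lv).1.
    split=> //; rewrite -{1}[v]mulg1 -gen_prod0.
    by apply: weak_le_gen_prod (sub0set _); apply: ascent_setS Jv.
  move=> /mulgI/gen_prod_inj->//; first exact: independentS Je.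
  by apply: independentS Je; apply: subset_trans sLJ.
exists {i : I | i \in J}, f; split; [split|].
- by [].
- move=> x y; rewrite !in_setE.
  move=> /(weak_interval_gen_prod _ Jv)[K sKJ ->].
  move=> /(weak_interval_gen_prod _ Jv)[L sLJ ->].
  move=> KL; suff -> : K = L by [].
  by apply/eqP; rewrite eqEsubset -(f_sub K L) // -(f_sub L K) // KL subxx.
- move=> U _; pose K := [set val t | t in U].
  have sKJ : K \subset J by apply/subsetP => i /imsetP[t _ ->]; exact: valP t.
  exists (v * gen_prod K); first by apply/weak_interval_gen_prod => //; exists K.
  by rewrite fE //; apply/setP => t; rewrite inE mem_imset //; apply: val_inj.
- move=> x y /(weak_interval_gen_prod _ Jv)[K sKJ ->].
  move=> /(weak_interval_gen_prod _ Jv)[L sLJ ->].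
  by rewrite f_sub //; apply: f_le.
Qed.

Lemma gen_prod_of_boolean v w : v <=w w ->
  boolean_poset s (weak_interval s v w) ->
  exists2 J, ascent_set v J & w = v * gen_prod J.
Proof.
move=> le_vw [T [f [[_ f_inj f_surj] f_le]]].
set A := weak_interval s v w in f_inj f_surj f_le.
have {f_surj} /choice[g gP] : forall U : {set T}, exists x, A x /\ f x = U.
  by move=> U; have [//|x Ax <-] := f_surj U; exists x.
have gA U : A (g U) by case: (gP U).
have gK U : f (g U) = U by case: (gP U).
have fK x : A x -> g (f x) = x.
  by move=> Ax; apply: f_inj; rewrite ?in_setE // gK.
have g_inj : injective g by apply: can_inj gK.
have Av : A v by split=> //; apply: weak_le_refl.
have Aw : A w by split=> //; apply: weak_le_refl.
have g0 : g finset.set0 = v.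
  rewrite -(fK v Av); congr g; apply/esym/eqP; rewrite -subset0 -(gK finset.set0).
  by apply/f_le => //; case: (gA finset.set0).
have gT : g [set: T]%SET = w.
  rewrite -(fK w Aw); congr g; apply/esym/eqP; rewrite -subTset -(gK [set: T]%SET).
  by apply/f_le => //; case: (gA [set: T]%SET).
(* No set lies strictly between [U] and [t |: U], so the first step of the weak order from [g U]
   towards [g (t |: U)] already arrives there. *)
have cover (U : {set T}) t : t \notin U ->
    exists i, g (t |: U) = g U * s i /\ i \notin descents s (g U).
  move=> tU; have sUt := subsetUr [set t] U.
  have leUt : g U <=w g (t |: U) by apply/f_le; rewrite ?gK.
  have [|i [le_i le_it len_i]] := weak_le_step gen_s invol_s leUt.
    by move/g_inj/setP/(_ t); rewrite setU11 (negbTE tU).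
  exists i; rewrite inE len_i -leqNgt leqnSn; split=> //.
  have Ai : A (g U * s i).
    case: (gA U) (gA (t |: U)) => leU _ [_ letU].
    by split; [apply: weak_le_trans leU le_i | apply: weak_le_trans letU].
  rewrite -(fK _ Ai); congr g; apply/eqP; rewrite eq_sym.
  have sub1 : U \subset f (g U * s i) by rewrite -{1}[U]gK; apply/f_le.
  have sub2 : f (g U * s i) \subset t |: U by rewrite -[t |: U]gK; apply/f_le.
  rewrite eqEsubset sub2 subUset sub1 sub1set andbT; apply: contraT => tf.
  have fU : f (g U * s i) = U.
    apply/eqP; rewrite eqEsubset sub1 andbT; apply/subsetP => u uf.
    have /setU1P[ut|//] := subsetP sub2 u uf.
    by rewrite -ut uf in tf.
  have := fK _ Ai; rewrite fU => gUi; move: len_i; rewrite -gUi.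
  by move/n_Sn.
have /choice[a aP] : forall t, exists i,
    g [set t]%SET = v * s i /\ i \notin descents s v.
  move=> t; have [|i] := cover finset.set0 t; first by rewrite inE.
  by rewrite setU0 g0; exists i.
have a_inj : injective a.
  move=> t u atu; apply: set1_inj; apply: g_inj.
  by rewrite (aP t).1 (aP u).1 atu.
(* The join of two covers is reached along two paths, which gives [s i * s l = s j * s k]; the
   indices required to be distinct are so because [g] is injective, and [gen_mul2_eq] applies. *)
have square (U : {set T}) t u i j : t != u -> t \notin U -> u \notin U ->
    g (t |: U) = g U * s i -> g (u |: U) = g U * s j ->
    g (t |: (u |: U)) = g U * s j * s i /\ commute (s j) (s i).
  move=> neq_tu tU uU gt gu.
  have tuU : t \notin u |: U by rewrite !inE negb_or neq_tu.
  have utU : u \notin t |: U by rewrite !inE negb_or eq_sym neq_tu.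
  have [k [gk _]] := cover _ _ tuU; have [l [gl _]] := cover _ _ utU.
  have neqU : g (t |: (u |: U)) <> g U.
    by move/g_inj/setP/(_ t); rewrite setU11 (negbTE tU).
  rewrite setUCA gt in gl; rewrite gu in gk; have gkl := gk.
  rewrite gl -!mulgA in gkl; move/mulgI in gkl.
  have neq_ij : i != j.
    apply: contra_neq neq_tu => ij; apply: set1_inj; apply/setP => z.
    have : g (t |: U) = g (u |: U) by rewrite gt gu ij.
    move=> /g_inj/setP/(_ z); rewrite !inE.
    by case: eqVneq => [->|_]; case: eqVneq => [->|_] //=;
      rewrite ?(negbTE tU) ?(negbTE uU).
  have neq_il : i != l.
    apply: contra_not_neq neqU => il; rewrite setUCA in gl.
    by rewrite setUCA gl il -mulgA invol_s mulg1.
  have neq_jk : j != k.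
    apply: contra_not_neq neqU => jk.
    by rewrite gk jk -mulgA invol_s mulg1.
  have [lj ki sijC] := gen_mul2_eq m_sl hW neq_ij neq_il neq_jk gkl.
  by rewrite gk ki; split=> //; apply/esym.
(* The label of the cover from [U] to [t |: U] depends on [t] alone: opposite sides of a square
   carry the same label, so it can be transported down to the empty set. *)
have g_step n : forall (U : {set T}) t, #|U| = n ->
    t \notin U -> g (t |: U) = g U * s (a t).
  elim: n => [|n IHn] U t cardU tU.
    by move/eqP: cardU; rewrite cards_eq0 => /eqP->; rewrite setU0 g0 (aP t).1.
  have /card_gt0P[u uU] : 0 < #|U| by rewrite cardU.
  have cardU' : #|U :\ u| = n by move: cardU; rewrite (cardsD1 u) uU => -[].
  have tU' : t \notin U :\ u by rewrite !inE (negbTE tU) andbF.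
  have uU' : u \notin U :\ u by rewrite setD11.
  have neq_tu : t != u by apply: contraNneq tU => ->.
  have := square _ _ _ _ _ neq_tu tU' uU' (IHn _ _ cardU' tU') (IHn _ _ cardU' uU').
  by rewrite -(IHn _ _ cardU' uU') setD1K // => -[].
pose aT := a @: [set: T]%SET.
have aTe : independent e aT.
  apply/independentP => _ _ /imsetP[t _ ->] /imsetP[u _ ->]; apply/edge_commuteP.
  have [->|neq_tu] := eqVneq t u; first by [].
  apply/commute_sym.
  have gE z : g (z |: finset.set0) = g finset.set0 * s (a z).
    by rewrite setU0 g0 (aP z).1.
  have := square finset.set0 t u _ _ neq_tu _ _ (gE t) (gE u).
  by rewrite !inE => -[].
have gE n : forall U : {set T}, #|U| = n -> g U = v * gen_prod (a @: U).
  elim: n => [|n IHn] U cardU.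
    by move/eqP: cardU; rewrite cards_eq0 => /eqP->; rewrite imset0 gen_prod0 g0 mulg1.
  have /card_gt0P[u uU] : 0 < #|U| by rewrite cardU.
  have cardU' : #|U :\ u| = n by move: cardU; rewrite (cardsD1 u) uU => -[].
  rewrite -{1}(setD1K uU) (g_step n) ?setD11 // (IHn _ cardU') -mulgA.
  have aUe : independent e (a @: U).
    by apply: independentS aTe; apply: imsetS; apply/subsetP.
  rewrite (gen_prodD1 aUe (imset_f a uU)); congr (_ * (gen_prod _ * _)).
  apply/setP => i; rewrite in_setD1; apply/imsetP/andP.
    by case=> t /setD1P[neq_tu tU] ->; rewrite (inj_eq a_inj) neq_tu imset_f.
  case=> neq_iu /imsetP[t tU iE]; exists t => //; rewrite !inE tU andbT.
  by apply: contraNneq neq_iu => <-; rewrite iE.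
exists aT; last by rewrite -gT (gE _ _ erefl).
rewrite /ascent_set aTe; apply/subsetP => i /imsetP[t _ ->].
by rewrite in_setC (aP t).2.
Qed.

Lemma boolean_intervals_image v :
  boolean_intervals_from s v =
    ((fun J => weak_interval s v (v * gen_prod J)) @`
       [set` [set J | ascent_set v J]%SET])%classic.
Proof.
apply/seteqP; split=> [A [w [le_vw -> Aw]]|A [J]] /=.
  by have [J Jv ->] := gen_prod_of_boolean le_vw Aw; exists J => //=; rewrite inE.
rewrite inE => Jv <-; exists (v * gen_prod J); split=> //; last exact: boolean_gen_prod.
rewrite -{1}[v]mulg1 -gen_prod0; apply: weak_le_gen_prod (sub0set _) => //.
Qed.

Lemma weak_interval_inj u w w' : u <=w w -> u <=w w' ->
  weak_interval s u w = weak_interval s u w' -> w = w'.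
Proof.
move=> uw uw' ww'; apply: (@weak_le_anti _ _ s gen_s).
- have : weak_interval s u w w by split=> //; apply: weak_le_refl.
  by rewrite ww' => -[].
- have : weak_interval s u w' w' by split=> //; apply: weak_le_refl.
  by rewrite -ww' => -[].
Qed.

Lemma card_boolean_intervals v :
  (boolean_intervals_from s v #= `I_#|[set J | ascent_set v J]|)%card.
Proof.
rewrite boolean_intervals_image; apply: card_eq_trans (card_finset _).
apply: inj_card_eq => J K; rewrite !in_setE /= !inE => Jv Kv JK.
have /andP[Je _] := Jv; have /andP[Ke _] := Kv.
apply: gen_prod_inj => //; apply: (mulgI v).
by apply: weak_interval_inj JK; rewrite -{1}[v]mulg1 -gen_prod0;
  apply: weak_le_gen_prod (sub0set _).
Qed.
End BooleanIntervals.

(** * Counting independent sets of a finite graph *)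

Section IndependentCount.
Variables (T : finType) (e : rel T).
Hypothesis e_sym : symmetric e.
Hypothesis e_irr : irreflexive e.
Implicit Types (A B J : {set T}) (x y : T).

Definition indep_sets A : {set {set T}} := [set J | independent e J & J \subset A].

Lemma card_indep_sets0 : #|indep_sets finset.set0| = 1.
Proof.
apply/eqP/cards1P; exists finset.set0; apply/setP => J; rewrite !inE subset0.
case: eqVneq => [->|]; last by rewrite andbF.
by rewrite andbT; apply/independentP => x; rewrite inE.
Qed.

Lemma independentU1 x J : (independent e (x |: J)) =
  independent e J && [forall y in J, ~~ e x y].
Proof.
apply/independentP/andP => [xJ|[/independentP Je /forall_inP xJ] y z].
  split; first by apply/independentP => y z yJ zJ; apply: xJ; apply: setU1r.
  by apply/forall_inP => y yJ; apply: xJ; rewrite ?setU11 ?setU1r.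
case/setU1P => [->|yJ] /setU1P[->|zJ]; rewrite ?e_irr //.
- exact: xJ.
- by rewrite e_sym; apply: xJ.
- exact: Je.
Qed.

(** The second term counts the sets that contain [x]: deleting [x] from them leaves an arbitrary
    independent set that avoids [x] and its neighbours. *)
Lemma card_indep_setsD1 A x : x \in A ->
  #|indep_sets A| =
    #|indep_sets (A :\ x)| + #|indep_sets [set y in A | (y != x) && ~~ e x y]|.
Proof.
move=> xA; set A' := [set y in A | _].
rewrite -(cardsID [set J : {set T} | x \in J] (indep_sets A)) addnC; congr (_ + _).
  by apply: eq_card => J; rewrite !inE subsetD1 andbC -andbA.
have xA' (J : {set T}) : J \subset A' -> x \notin J.
  by move=> /subsetP sJ; apply/negP => /sJ; rewrite !inE eqxx andbF.
have -> : indep_sets A :&: [set J : {set T} | x \in J] =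
    [set x |: J | J in indep_sets A'].
  apply/setP => J; rewrite !inE; apply/andP/imsetP => [[/andP[Je sJA] xJ]|[K]].
    exists (J :\ x); rewrite ?setD1K // inE (independentS (subD1set J x) Je).
    apply/subsetP => y /setD1P[neq_yx yJ]; rewrite !inE neq_yx (subsetP sJA) //=.
    by move/independentP: Je; apply.
  rewrite inE => /andP[Ke /subsetP sK] ->; rewrite setU11 independentU1 Ke /=.
  rewrite subUset sub1set xA /=; split=> //; apply/andP; split.
    by apply/forall_inP => y /sK; rewrite inE => /and3P[].
  by apply/subsetP => y /sK; rewrite inE => /andP[].
rewrite card_in_imset // => J K; rewrite !inE => /andP[_ /xA' xJ] /andP[_ /xA' xK] JK.
by rewrite -(setU1K xJ) JK setU1K.
Qed.

(** Taking unions is a bijection from pairs, inverted by intersecting with [A] and with [B]. *)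
Lemma card_indep_setsU A B : [disjoint A & B] ->
    {in A & B, forall x y, ~~ e x y} ->
  #|indep_sets (A :|: B)| = #|indep_sets A| * #|indep_sets B|.
Proof.
move=> disAB eAB; rewrite -cardsX.
have trace (J K : {set T}) : J \subset A -> K \subset B ->
    (J :|: K) :&: A = J /\ (J :|: K) :&: B = K.
  move=> sJ sK; rewrite !setIUl; split.
    rewrite (setIidPl sJ) (_ : K :&: A = finset.set0) ?setU0 //.
    by apply/eqP; rewrite setI_eq0 disjoint_sym; apply: disjointWr disAB.
  rewrite (setIidPl sK) (_ : J :&: B = finset.set0) ?set0U //.
  by apply/eqP; rewrite setI_eq0; apply: disjointWl disAB.
have -> : indep_sets (A :|: B) =
    [set p.1 :|: p.2 | p in finset.setX (indep_sets A) (indep_sets B)].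
  apply/setP => J; rewrite inE; apply/andP/imsetP => [[Je sJ]|[[K L]]].
    exists (J :&: A, J :&: B) => /=; last by rewrite -setIUr (setIidPl sJ).
    by rewrite !inE !subsetIr !(independentS (subsetIl _ _) Je).
  rewrite !inE /= => /andP[/andP[/independentP Ke sK] /andP[/independentP Le sL]] ->.
  split; last exact: setUSS.
  apply/independentP => x y /setUP[xK|xL] /setUP[yK|yL].
  - exact: Ke.
  - by apply: eAB; [apply: (subsetP sK) | apply: (subsetP sL)].
  - by rewrite e_sym; apply: eAB; [apply: (subsetP sK) | apply: (subsetP sL)].
  - exact: Le.
rewrite card_in_imset // => -[J K] [J' K'].
rewrite !inE /= => /andP[/andP[_ sJ] /andP[_ sK]] /andP[/andP[_ sJ'] /andP[_ sK']] eqU.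
have [JE KE] := trace _ _ sJ sK; have [JE' KE'] := trace _ _ sJ' sK'.
by rewrite eqU in JE KE; congr pair; [rewrite -JE JE' | rewrite -KE KE'].
Qed.

Lemma card_indep_sets_cover (P : {set {set T}}) : finset.trivIset P ->
    {in P &, forall B C, B != C -> {in B & C, forall x y, ~~ e x y}} ->
  #|indep_sets (cover P)| = \prod_(B in P) #|indep_sets B|.
Proof.
move: {2}#|P| (erefl #|P|) => k; elim: k P => [|k IHk] P.
  by move/eqP; rewrite cards_eq0 => /eqP-> _ _; rewrite /cover !big_set0 card_indep_sets0.
move=> cardP triP eP; have /card_gt0P[B BP] : 0 < #|P| by rewrite cardP.
rewrite (big_setD1 B BP) /= /cover (big_setD1 B BP) /= card_indep_setsU.
- congr (_ * _); apply: IHk.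
  + by move: cardP; rewrite (cardsD1 B) BP => -[].
  + exact: finset.trivIsetS (subD1set P B) triP.
  + by move=> C D /setD1P[_ CP] /setD1P[_ DP]; apply: eP.
- apply/bigcup_disjointP => C /setD1P[neq_CB CP].
  by rewrite disjoint_sym; apply: (finset.trivIsetP triP).
- move=> x y xB /bigcupP[C /setD1P[neq_CB CP] yC].
  by apply: (eP B C) => //; rewrite eq_sym.
Qed.

(** * Connected components of an induced subgraph *)

Variable A : {set T}.

Lemma induced_edge_sym : symmetric (induced_edge e A).
Proof. by move=> x y; rewrite /induced_edge /= e_sym andbCA. Qed.

Lemma induced_connect_equiv : {in A & &, equivalence_rel (connect (induced_edge e A))}.
Proof.
move=> x y z _ _ _; split; first exact: connect0.
by move=> xy; apply: (same_connect (sym_connect_sym induced_edge_sym) xy).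
Qed.

Lemma components_partition : finset.partition (components e A) A.
Proof. exact: equivalence_partitionP induced_connect_equiv. Qed.

Lemma component_sub B : B \in components e A -> B \subset A.
Proof.
have /and3P[/eqP covA _ _] := components_partition => BP.
by apply/subsetP => x xB; rewrite -covA; apply/bigcupP; exists B.
Qed.

Lemma mem_component B x y : B \in components e A -> x \in B -> y \in A ->
  (y \in B) = connect (induced_edge e A) x y.
Proof.
have /and3P[_ triP _] := components_partition => BP xB yA.
rewrite -(finset.def_pblock triP BP xB) pblock_equivalence_partition //.
  exact: induced_connect_equiv.
exact: subsetP (component_sub BP) x xB.
Qed.

Lemma component_edge B x y : B \in components e A -> x \in B ->
  induced_edge e A x y -> y \in B.
Proof.
move=> BP xB xy; have /and3P[_ yA _] := xy.
by rewrite (mem_component BP xB yA) connect1.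
Qed.

(** Serves to bound a component from above: [D :&: B] is closed under induced edges, hence contains
    everything connected to [x]. *)
Lemma component_ind B x (D : {set T}) : B \in components e A -> x \in B ->
    x \in D -> {in D & B, forall y z, y \in B -> e y z -> z \in D} ->
  B \subset D.
Proof.
move=> BP xB xD clD; apply/subsetP => z zB.
have zA := subsetP (component_sub BP) z zB.
have clDB : closed (induced_edge e A) (mem (D :&: B)).
  suff imp y w : induced_edge e A y w -> y \in D :&: B -> w \in D :&: B.
    by move=> y w yw; apply/idP/idP; apply: imp; rewrite // induced_edge_sym.
  move=> yw /setIP[yD yB]; have wB := component_edge BP yB yw.
  by rewrite inE wB andbT; apply: clD yD wB yB _; case/and3P: yw.
have := zB; rewrite (mem_component BP xB zA) => /(closed_connect clDB).
by rewrite !inE xD xB => /esym/andP[].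
Qed.

Lemma component_neq0 B : B \in components e A -> exists x, x \in B.
Proof.
have /and3P[_ _ P0] := components_partition => BP; apply/set0Pn.
by apply: contraNneq P0 => <-.
Qed.

Lemma component_uniq B C x : B \in components e A -> C \in components e A ->
  x \in B -> x \in C -> B = C.
Proof.
have /and3P[_ triP _] := components_partition => BP CP xB xC.
by rewrite -(finset.def_pblock triP BP xB) (finset.def_pblock triP CP xC).
Qed.

Lemma card_indep_sets_components :
  #|indep_sets A| = \prod_(B in components e A) #|indep_sets B|.
Proof.
have /and3P[/eqP covA triP _] := components_partition.
rewrite -{1}covA card_indep_sets_cover // => B C BP CP neq_BC x y xB yC.
apply: contra_neqN neq_BC => xy; apply: (component_uniq BP CP _ yC).
apply: (component_edge BP xB); rewrite /induced_edge /= xy.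
by rewrite (subsetP (component_sub BP)) // (subsetP (component_sub CP)).
Qed.
End IndependentCount.

(** * Arms of the graph of type D_n and their independent sets *)

Section TypeD.
Variable n : nat.
Hypothesis n_ge2 : 2 <= n.
Local Notation m := (@D_matrix n).
Local Notation e := (coxeter_graph m).

Lemma D_simply_laced : simply_laced m.
Proof.
split=> [[i|]|[i|] [j|]|[i|] [j|]] //=; rewrite ?eqxx //.
- by rewrite [j == i]eq_sym orbC.
- by rewrite (inj_eq Some_inj) => /negbTE->; case: ifP; [right | left].
- by case: ifP; [right | left].
- by case: ifP; [right | left].
Qed.

Lemma D_edge_sym : symmetric e.
Proof. by case: D_simply_laced => _ m_sym _ x y; rewrite /coxeter_graph /= m_sym. Qed.

Lemma D_edge_irr : irreflexive e.
Proof. by case: D_simply_laced => m_diag _ _ x; rewrite /coxeter_graph /= m_diag. Qed.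

Lemma D_edgeSS (i j : 'I_n.-1) :
  e (Some i) (Some j) = (i.+1 == j :> nat) || (j.+1 == i :> nat).
Proof.
rewrite /coxeter_graph /=; case: eqVneq => [->|_]; last by case: ifP.
by rewrite orbb; apply/esym/negbTE; rewrite neq_ltn ltnSn orbT.
Qed.

Lemma D_edgeSN (i : 'I_n.-1) : e (Some i) None = (i + 3 == n).
Proof. by rewrite /coxeter_graph /=; case: ifP. Qed.

Lemma D_edgeNS (i : 'I_n.-1) : e None (Some i) = (i + 3 == n).
Proof. by rewrite /coxeter_graph /=; case: ifP. Qed.

Definition D_edgeE := (D_edgeSS, D_edgeSN, D_edgeNS, D_edge_irr).

(* The arm [s_(a+1), ..., s_c], together with [s'_(n-1)] when [b] holds. *)
Definition arm (b : bool) (a c : nat) : {set D_gen n} :=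
  [set x : option 'I_n.-1 | if x is Some i then a <= i < c else b].

Lemma mem_armS b a c (i : 'I_n.-1) : (Some i \in arm b a c) = (a <= i < c).
Proof. by rewrite inE. Qed.

Lemma mem_armN b a c : (None \in arm b a c) = b.
Proof. by rewrite inE. Qed.

Lemma arm0 a c : c <= a -> arm false a c = finset.set0.
Proof. by move=> le_ca; apply/setP => -[i|]; rewrite !inE //; lia. Qed.

Lemma armN a c : c <= a -> arm true a c = [set None].
Proof. by move=> le_ca; apply/setP => -[i|]; rewrite !inE //=; apply/negbTE; lia. Qed.

Section ArmStep.
Variables (b : bool) (a c : nat).
Hypotheses (lt_ac : a < c) (le_cn : c <= n.-1).

Let a0 : 'I_n.-1 := Ordinal (leq_trans lt_ac le_cn).

Lemma arm_head : Some a0 \in arm b a c.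
Proof. by rewrite mem_armS leqnn. Qed.

Lemma armD1 : arm b a c :\ Some a0 = arm b a.+1 c.
Proof.
apply/setP => -[i|]; rewrite in_setD1 !inE //=.
by rewrite (inj_eq Some_inj) -val_eqE /=; lia.
Qed.

Lemma card_arm_step : #|arm b a c| = #|arm b a.+1 c|.+1.
Proof. by rewrite (cardsD1 (Some a0)) arm_head armD1. Qed.

(** Deletion at the head of the arm. Its neighbours within the arm are the next index and, if
    [a + 3 = n] makes it the branch vertex, also [None]. *)
Lemma card_indep_arm_step : #|indep_sets e (arm b a c)| =
  #|indep_sets e (arm b a.+1 c)| + #|indep_sets e (arm (b && (a + 3 != n)) a.+2 c)|.
Proof.
rewrite (card_indep_setsD1 D_edge_sym D_edge_irr arm_head) armD1.
congr (_ + #|indep_sets _ _|); apply/setP => -[i|]; rewrite inE !inE D_edgeE //=.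
by rewrite (inj_eq Some_inj) -val_eqE /=; lia.
Qed.

End ArmStep.

Lemma card_arm b a c : c <= n.-1 -> #|arm b a c| = b + (c - a).
Proof.
move=> le_cn; move: {2}(c - a) (erefl (c - a)) => k.
elim: k a => [|k IHk] a ca.
  have le_ca : c <= a by lia.
  by rewrite ca addn0; case: b; [rewrite armN ?cards1 | rewrite arm0 ?cards0].
by rewrite card_arm_step ?(IHk a.+1) //; lia.
Qed.

Lemma card_indep_none : #|indep_sets e [set None]| = 2.
Proof.
have N1 : None \in [set None : D_gen n] by rewrite inE.
rewrite (card_indep_setsD1 D_edge_sym D_edge_irr N1).
have -> : [set None] :\ None = finset.set0 :> {set D_gen n} by rewrite setDv.
rewrite (_ : [set y in _ | _] = finset.set0) ?card_indep_sets0 //.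
by apply/setP => x; rewrite !inE; case: eqVneq.
Qed.

Lemma card_indep_path a c : c <= n.-1 ->
  #|indep_sets e (arm false a c)| = fib (c - a + 2).
Proof.
move=> le_cn; move: {2}(c - a) (erefl (c - a)) => k.
elim/ltn_ind: k a => k IHk a ca; have [le_ca|lt_ac] := leqP c a.
  have -> : c - a = 0 by lia.
  by rewrite arm0 // card_indep_sets0.
rewrite card_indep_arm_step // (IHk (c - a.+1)) ?(IHk (c - a.+2)) //; try lia.
(* A single vertex is treated apart, because [c - a.+2] is then truncated to 0. *)
case: k ca {IHk} => [|[|k]] ca; first by lia.
  by have [-> -> ->] : [/\ c - a = 1, c - a.+1 = 0 & c - a.+2 = 0] by split; lia.
by have [-> -> ->] : [/\ c - a = k.+2, c - a.+1 = k.+1 & c - a.+2 = k] by split; lia.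
Qed.

(** Without [s_(n-1)], the vertex [None] simply ends the path one step after the branch vertex, so
    there are [n - 2 - a + 1] vertices. *)
Lemma card_indep_path_branch a : a <= n - 2 ->
  #|indep_sets e (arm true a (n - 2))| = fib (n - 2 - a + 3).
Proof.
move: {2}(n - 2 - a) (erefl (n - 2 - a)) => k.
elim/ltn_ind: k a => k IHk a ca le_an; have [le_na|lt_an] := leqP (n - 2) a.
  have -> : n - 2 - a = 0 by lia.
  by rewrite armN // card_indep_none.
rewrite card_indep_arm_step ?(IHk (n - 2 - a.+1)) //; try lia.
have [an|an] := boolP (a + 3 == n).
  have [-> ->] : n - 2 - a = 1 /\ n - 2 - a.+1 = 0 by lia.
  by rewrite arm0 ?card_indep_sets0 //; lia.
rewrite (IHk (n - 2 - a.+2)) //; try lia.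
case: k ca {IHk} => [|[|k]] ca; try by lia.
by have [-> -> ->] : [/\ n - 2 - a = k.+2, n - 2 - a.+1 = k.+1 & n - 2 - a.+2 = k]
  by split; lia.
Qed.

(** The recurrence starts with the two non-adjacent ends of the fork, which have four independent
    sets. *)
Lemma card_indep_fork a : a <= n - 2 ->
  #|indep_sets e (arm true a n.-1)| = d_seq (n - a).
Proof.
move: {2}(n - a) (erefl (n - a)) => k.
elim/ltn_ind: k a => k IHk a ca le_an.
have [an|lt_an] := eqVneq a (n - 2).
  rewrite card_indep_arm_step //; try lia.
  rewrite (_ : n - a = 2); last by lia.
  rewrite !armN ?card_indep_none; try lia.
  have -> : (a + 3 != n) by lia.
  by rewrite armN ?card_indep_none //; lia.
rewrite card_indep_arm_step ?(IHk (n - a.+1)) //; try lia.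
(* At the branch vertex the second term leaves no vertex, and its single independent set matches
   [d_seq 1 = 1]. *)
have [an|an] := boolP (a + 3 == n).
  have [-> ->] : n - a = 3 /\ n - a.+1 = 2 by lia.
  by rewrite arm0 ?card_indep_sets0 //; lia.
rewrite (IHk (n - a.+2)) //; try lia.
case: k ca {IHk} => [|[|[|k]]] ca; try by lia.
by have [-> -> ->] : [/\ n - a = k.+3, n - a.+1 = k.+2 & n - a.+2 = k.+1]
  by split; lia.
Qed.

(** * Shapes of the components and the product formula *)

Section Components.
Variable A : {set D_gen n}.

(** The three shapes are a path without [None], a path ending in [None] instead of [s_(n-1)], and a
    fork with both ends. The run of indices from the least one in [B], with [None] added where it is
    adjacent, is closed under the edges of [B]. *)
Lemma component_arm B : B \in components e A ->
  exists b a c, [/\ B = arm b a c, c <= n.-1 &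
    [\/ b = false, [/\ b = true, c = n - 2 & a <= n - 2]
       | [/\ b = true, c = n.-1 & a + 3 <= n]]].
Proof.
move=> BP; pose inB k := [exists i : 'I_n.-1, (i == k :> nat) && (Some i \in B)].
have inBE (i : 'I_n.-1) : inB i = (Some i \in B).
  apply/existsP/idP => [[j /andP[/eqP/val_inj->]]//|iB].
  by exists i; rewrite eqxx.
have inB_lt k : inB k -> k < n.-1 by case/existsP => i /andP[/eqP<- _].
have [ex_a|noS] := pselect (exists k, inB k); last first.
  (* The component consisting of [None] alone is an arm with an empty run of indices. *)
  exists true, (n - 2), (n - 2); split; [|lia|by constructor 2].
  have [x xB] := component_neq0 D_edge_sym BP; rewrite armN //.
  have BN y : y \in B -> y = None.
    by case: y => // i iB; case: noS; exists (i : nat); rewrite inBE.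
  apply/setP => y; rewrite inE; apply/idP/eqP => [/BN//|->].
  by rewrite -(BN x).
have [a aB a_min] := ex_minnP ex_a; have lt_an := inB_lt a aB.
(* The run ends at the first index outside [B], or at [n.-1] if there is none. *)
have ex_c : exists k, (a <= k) && ((k == n.-1) || ~~ inB k).
  by exists n.-1; rewrite eqxx andbT ltnW.
have [c /andP[le_ac cP] c_min] := ex_minnP ex_c.
have le_cn : c <= n.-1 by apply: c_min; rewrite eqxx andbT ltnW.
have run k : a <= k < c -> inB k.
  move=> /andP[le_ak lt_kc]; apply: contraT => kB.
  by have := c_min k; rewrite le_ak kB orbT leqNgt lt_kc => /(_ isT).
have lt_ac : a < c.
  rewrite ltn_neqAle le_ac andbT; apply: contraTneq cP => <-.
  by rewrite aB orbF; lia.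
have head : Some (Ordinal lt_an) \in B by rewrite -inBE.
(* The condition [full] says that the run from [a] to [c] contains [n - 3], the index of the branch
   vertex, the only neighbour of [None]. *)
pose full := (n - 2 <= c) && (a + 3 <= n).
have sBD : B \subset arm full a c.
  apply: (component_ind D_edge_sym BP head); first by rewrite mem_armS leqnn.
  move=> y z yD zB yB; case: y z yD zB yB => [i|] [j|];
    rewrite ?mem_armS ?mem_armN ?D_edgeE -?inBE // => yD zB yB.
  - have := a_min _ zB; have := ltn_ord j.
    have /orP[/eqP->|cB] := cP; first by lia.
    have : j != c :> nat by apply: contraNneq cB => <-.
    by rewrite /full; lia.
  - by rewrite /full; lia.
  - by have := a_min _ zB; move: yD; rewrite /full; lia.
have BE : B = arm (None \in B) a c.
  apply/setP => -[i|]; rewrite ?mem_armS ?mem_armN //; apply/idP/idP => [iB|/run].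
    by have := subsetP sBD _ iB; rewrite mem_armS.
  by rewrite inBE.
exists (None \in B), a, c; split=> //.
case: (boolP (None \in B)) => [NB|_]; last by constructor 1.
have := subsetP sBD _ NB; rewrite mem_armN => /andP[le_nc le_an].
have [cE|neq_cn] := eqVneq c n.-1; [constructor 3 | constructor 2]; split=> //; lia.
Qed.

Lemma degree3 x : induced_degree e A x = 3 -> exists i j : 'I_n.-1,
  [/\ x = Some i, i + 3 = n, j + 2 = n,
      induced_edge e A x None & induced_edge e A x (Some j)].
Proof.
rewrite /induced_degree; set N := [set y | _] => degx.
(* Three neighbours cannot be separated by a Boolean. Each unwanted case below exhibits such a
   separation: [None] has at most one neighbour, and an index lacking [None] or [s_(n-1)] next to it
   has at most two. *)
have no_inj (h : D_gen n -> bool) : {in N &, injective h} -> False.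
  by move=> /card_in_imset hN; have := max_card (h @: N); rewrite hN degx card_bool.
have NE y : y \in N = induced_edge e A x y by rewrite inE.
case: x @N degx no_inj NE => [i|] N degx no_inj NE; last first.
  case: (no_inj (fun=> true)) => -[j|] [k|];
    rewrite !NE /induced_edge /= ?D_edgeE => /and3P[_ _ xj] /and3P[_ _ xk] _ //.
  by congr Some; apply: val_inj => /=; lia.
have SE j : Some j \in N -> (i.+1 == j) || (j.+1 == i).
  by rewrite NE /induced_edge /= D_edgeE => /and3P[].
have NN : None \in N.
  apply: contraT => NN.
  case: (no_inj (fun y => if y is Some j then i < j else false)) => -[j|] [k|];
    rewrite ?(negbTE NN) // => /SE jN /SE kN jk.
  by congr Some; apply: val_inj => /=; lia.
have /existsP[j /andP[/eqP jn jN]] :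
    [exists j : 'I_n.-1, (j + 2 == n) && (Some j \in N)].
  apply: contraT; rewrite negb_exists => /forallP noj.
  have iN : i + 3 == n by move: NN; rewrite NE /induced_edge /= D_edgeE => /and3P[].
  case: (no_inj (fun y => if y is Some j then true else false)) => -[j|] [k|] //.
  move=> jN kN _; have := noj j; have := noj k; rewrite jN kN !andbT.
  by move/SE: jN; move/SE: kN => *; congr Some; apply: val_inj => /=; lia.
exists i, j; split; rewrite // -?NE //.
by move: NN; rewrite NE /induced_edge /= D_edgeE => /and3P[_ _ /eqP].
Qed.

Definition branched (B : {set D_gen n}) : bool :=
  [exists x in B, induced_degree e A x == 3].

Lemma card_indep_component B : B \in components e A ->
  #|indep_sets e B| = if branched B then d_seq #|B| else fib (#|B| + 2).
Proof.
move=> BP; have [b [a [c [BE le_cn bP]]]] := component_arm BP.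
have branchP : branched B -> None \in B /\ exists2 j : 'I_n.-1, j + 2 = n & Some j \in B.
  case/existsP => x /andP[xB /eqP/degree3[i [j [_ _ jn xN xj]]]].
  split; first exact: (component_edge D_edge_sym BP xB xN).
  by exists j => //; apply: (component_edge D_edge_sym BP xB xj).
have cardB : #|B| = b + (c - a) by rewrite {1}BE card_arm.
case: bP BE cardB => [->|[-> -> le_an]|[-> cE le_an]] BE cardB.
- have -> : branched B = false by apply: contraTF isT => /branchP[]; rewrite BE mem_armN.
  by rewrite cardB BE card_indep_path.
- have -> : branched B = false.
    by apply: contraTF isT => /branchP[_ [j jn]]; rewrite BE mem_armS; lia.
  by rewrite cardB BE card_indep_path_branch //; congr fib; lia.
rewrite cE in cardB BE; have -> : #|B| = n - a by lia.
rewrite BE card_indep_fork; last by lia.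
(* A fork with three vertices is a path with no vertex of degree three, but both formulas give 5. *)
have [an|lt_an] := leqP n (a + 3).
  by rewrite (_ : n - a = 3); [case: ifP | lia].
(* With at least four vertices, the index [n - 4] also belongs to the fork, so the branch vertex
   [n - 3] has the neighbours [None], [n - 2] and [n - 4]. *)
suff -> : branched (arm true a n.-1) by [].
have n3 : n - 3 < n.-1 by lia.
have n4 : n - 4 < n.-1 by lia.
have n2 : n - 2 < n.-1 by lia.
have mem_arm x : x \in arm true a n.-1 -> x \in A.
  by rewrite -BE; apply/subsetP/(component_sub D_edge_sym BP).
apply/existsP; exists (Some (Ordinal n3)).
have xB : Some (Ordinal n3) \in arm true a n.-1 by rewrite mem_armS /=; lia.
rewrite xB /induced_degree /=.
rewrite (_ : [set y | _] = [set None; Some (Ordinal n2); Some (Ordinal n4)]).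
  rewrite -setUA cardsU1 !inE /= cards2 (inj_eq Some_inj) -val_eqE /=.
  by rewrite (_ : (n - 2 != n - 4)); last by lia.
apply/setP => -[i|]; rewrite !inE /induced_edge /= (mem_arm _ xB) D_edgeE /=; last first.
  by rewrite mem_arm ?mem_armN //=; lia.
rewrite !(inj_eq Some_inj) -!val_eqE /=.
have [iA|iA] := boolP (Some i \in A); first by lia.
have : Some i \notin arm true a n.-1 by apply: contra iA; apply: mem_arm.
by rewrite mem_armS /=; have := ltn_ord i; lia.
Qed.

Lemma branched_uniq B C : B \in components e A -> C \in components e A ->
  branched B -> branched C -> B = C.
Proof.
move=> BP CP /existsP[x /andP[xB /eqP/degree3[i [_ [xE iN _ _ _]]]]].
case/existsP=> y /andP[yC /eqP/degree3[j [_ [yE jN _ _ _]]]].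
have xy : x = y by rewrite xE yE; congr Some; apply: val_inj => /=; lia.
by apply: (component_uniq D_edge_sym BP CP xB); rewrite xy.
Qed.

Lemma card_indep_D : let b0 := branch_component e A in
  #|indep_sets e A| =
    d_seq #|b0| * \prod_(B in components e A :\ b0) fib (#|B| + 2).
Proof.
rewrite /= (card_indep_sets_components D_edge_sym) /branch_component.
case: pickP => [B0 /andP[B0P B0b]|noB] /=.
  rewrite (big_setD1 B0 B0P) /= card_indep_component // [branched B0]B0b.
  congr (_ * _); apply: eq_bigr => B /setD1P[neq_BB0 BP].
  rewrite card_indep_component //; case: ifP => // Bb.
  by rewrite (branched_uniq BP B0P Bb B0b) eqxx in neq_BB0.
(* With no branched component [b0] is empty: it is not a component, so its removal changes nothing,
   and [d_seq 0 = 1] contributes a trivial factor. *)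
have -> : components e A :\ finset.set0 = components e A.
  have /and3P[_ _ P0] := components_partition D_edge_sym A.
  by apply/setDidPl; rewrite disjoint_sym disjoints1.
rewrite cards0 mul1n; apply: eq_bigr => B BP.
by rewrite card_indep_component //; have := noB B; rewrite /= BP /= /branched => ->.
Qed.
End Components.
End TypeD.

(** * The count of Boolean intervals in type D_n *)

Local Open Scope classical_set_scope.
Local Open Scope card_scope.

Theorem theorem3p13 (n : nat) (hn : 2 <= n)
    (W : groupType) (s : D_gen n -> W)
    (hW : coxeter_system (@D_matrix n) s) (v : W) :
  let e := coxeter_graph (@D_matrix n) in
  let A := (~: descents s v)%SET in
  let b0 := branch_component e A in
  boolean_intervals_from s v #=
    `I_(d_seq #|b0| * \prod_(B in (components e A :\ b0)%SET) fib (#|B| + 2)).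
Proof.
rewrite /= -(card_indep_D hn).
have -> : indep_sets (coxeter_graph (@D_matrix n)) (~: descents s v)%SET =
    [set J | ascent_set (@D_matrix n) s v J]%SET by [].
exact: card_boolean_intervals (D_simply_laced n) hW v.
Qed.
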